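(* Let $m$ and $\lambda$ be positive integers with $\lambda$ odd, and suppose that $\{S_1,S_2,\dots,S_t\}$ is a set of mutually orthogonal frequency squares (MOFS) of type $F(m\lambda;\lambda)$ satisfying a non-constant full relation. Then $\{S_1,S_2,\dots,S_t\}$ is a maximal set of MOFS of type $F(m\lambda;\lambda)$.
   Context: A frequency square (F-square) of type $F(m\lambda;\lambda)$ is an $m\lambda\times m\lambda$ array with entries in the symbol set $\{1,2,\dots,m\}$ such that each symbol appears exactly $\lambda$ times in each row and exactly $\lambda$ times in each column. Two F-squares $S$ and $S'$ of type $F(m\lambda;\lambda)$ are orthogonal if each ordered pair of symbols $(j,j')\in\{1,\dots,m\}^2$ appears exactly $\lambda^2$ times in the superposition of $S$ on $S'$, i.e. there are exactly $\lambda^2$ positions at which $S$ has entry $j$ and $S'$ has entry $j'$. A set of mutually orthogonal frequency squares (MOFS) of type $F(m\lambda;\lambda)$ is a set of pairwise orthogonal F-squares of that type. Such a set is maximal if it is not extendible to a larger set of MOFS of the same type, i.e. there is no F-square of type $F(m\lambda;\lambda)$ that is orthogonal to every member of the set. For an F-square $S=(S_{ij})$, the indicator square $I_1(S)$ is the $m\lambda\times m\lambda$ integer array whose $(i,j)$ entry is $1$ if $S_{ij}=1$ and $0$ otherwise. For an integer array $A$, $A \bmod 2$ is the elementwise reduction of $A$ modulo $2$, with entries in $\{0,1\}$. Let $x,y$ be integers with $0\le x,y\le m\lambda$ such that $x,y$ do not both belong to $\{0,m\lambda\}$. A set $\{S_1,\dots,S_t\}$ of F-squares of type $F(m\lambda;\lambda)$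 satisfies a non-constant full relation with respect to $x$ and $y$ if, after some permutation of the rows and some permutation of the columns, the array $\big(\sum_{k=1}^t I_1(S_k)\big)\bmod 2$ has the block structure $$\begin{bmatrix} \mathbf{0} & J\\ J & \mathbf{0}\end{bmatrix},$$ where the upper left block has $x$ rows and $y$ columns, the lower right block has $m\lambda-x$ rows and $m\lambda-y$ columns, $\mathbf{0}$ denotes an all-zeroes block and $J$ an all-ones block (blocks may be empty). The set satisfies a non-constant full relation if it does so with respect to some such $x$ and $y$. *)

(* Defs.v *)
From HB Require Import structures.
From mathcomp Require Import all_boot all_order all_fingroup all_algebra.

Set Implicit Arguments.
Unset Strict Implicit.
Unset Printing Implicit Defensive.

Import GRing.Theory.
Local Open Scope ring_scope.

(* The symbol s of {1, ..., m} is encoded as the ordinal of value s - 1. *)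
Notation square m lam := 'M['I_m]_(m * lam)%N.

Definition is_fsquare (m lam : nat) (S : square m lam) : Prop :=
  (forall (i : 'I_(m * lam)) (s : 'I_m), #|[set j | S i j == s]| = lam) /\
  (forall (j : 'I_(m * lam)) (s : 'I_m), #|[set i | S i j == s]| = lam).

Definition orthogonal_fsquares (m lam : nat) (S S' : square m lam) : Prop :=
  forall s s' : 'I_m,
    #|[set p : 'I_(m * lam) * 'I_(m * lam) |
        (S p.1 p.2 == s) && (S' p.1 p.2 == s')]| = (lam ^ 2)%N.

Definition is_MOFS (m lam : nat) (A : {set square m lam}) : Prop :=
  (forall S, S \in A -> is_fsquare S) /\
  (forall S S', S \in A -> S' \in A -> S != S' -> orthogonal_fsquares S S').

Definition is_maximal_MOFS (m lam : nat) (A : {set square m lam}) : Prop :=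
  is_MOFS A /\
  ~ (exists S : square m lam,
       is_fsquare S /\ forall S', S' \in A -> orthogonal_fsquares S S').

(* I_1(S): the symbol 1 is the ordinal of value 0. *)
Definition indicator1 (m lam : nat) (S : square m lam) : 'M[int]_(m * lam) :=
  \matrix_(i, j) (if S i j == 0%N :> nat then 1 else 0).

Definition mod2_mx (n : nat) (A : 'M[int]_n) : 'M[int]_n :=
  map_mx (fun a : int => (a %% 2)%Z) A.

(* The block matrix [0 J; J 0] with upper left block of size x * y; written
   entrywise, since block_mx would require casting x + (n - x) to n. *)
Definition relation_pattern (n x y : nat) : 'M[int]_n :=
  \matrix_(i, j)
    (if (i < x)%N then (if (j < y)%N then 0 else 1)
                  else (if (j < y)%N then 1 else 0)).

Definition full_relation (m lam : nat) (A : {set square m lam})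
    (x y : nat) : Prop :=
  exists r c : 'S_(m * lam),
    row_perm r (col_perm c (mod2_mx (\sum_(S in A) indicator1 S)))
      = relation_pattern (m * lam) x y.

Definition nonconstant_full_relation (m lam : nat)
    (A : {set square m lam}) : Prop :=
  exists x y : nat,
    [/\ (x <= m * lam)%N, (y <= m * lam)%N,
        ~ ((x = 0%N \/ x = (m * lam)%N) /\ (y = 0%N \/ y = (m * lam)%N))
      & full_relation A x y].

(* Main.v *)
(** For an F-square [T] and a symbol [s], let [N T s] be the parity of the sum
    of the entries of the squares [I_1(S_k)] over the cells where [T] has entry
    [s].  The full relation says that, modulo 2, [sum_k I_1(S_k)] has entries
    [P i + Q j], and since [s] occurs [lam] times per row and column, [N T s]
    is the parity of [lam * (#|P| + #|Q|)], whatever [T] and [s] are.  If [T]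
    is orthogonal to all [t] squares, then [N T s] is the parity of
    [t * lam ^ 2]; but for [T = S_1] and [s <> 1] it is the parity of
    [(t - 1) * lam ^ 2].  As [lam] is odd these differ.  Nonconstancy only
    serves to guarantee that [t > 0] and [m > 1]. *)

Require Import Defs.
From mathcomp Require Import all_boot all_order all_fingroup all_algebra.

Section Parity.

Set Implicit Arguments.
Unset Strict Implicit.

Variables m lam : nat.
Implicit Types (T S : square m lam) (A : {set square m lam}).

Definition ones A (p : 'I_(m * lam) * 'I_(m * lam)) : nat :=
  \sum_(S in A) (S p.1 p.2 == 0 :> nat).

Lemma full_relation_odd A x y :
  full_relation A x y ->
  exists r c : 'S_(m * lam),
    forall i j, odd (ones A (r i, c j)) = (i < x) (+) (j < y).
Proof.
move=> [r [c /matrixP E]]; exists r, c => i j.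
have := E i j; rewrite !mxE summxE /=.
have -> : (\sum_(S in A) indicator1 S (r i) (c j))%R = Posz (ones A (r i, c j)).
  rewrite /ones (big_morph Posz PoszD (erefl (Posz 0))).
  by apply: eq_bigr => S _; rewrite !mxE; case: (_ == _).
rewrite modz_nat modn2.
by case: (odd _); case: (i < x); case: (j < y).
Qed.

(** Modulo 2, [f] splits into a row part and a column part. Counting the first row by row and the
    second column by column, each row in [P] and each column in [Q] contributes [lam] cells. *)
Lemma odd_sum_fsquare T (s : 'I_m) (f : 'I_(m * lam) * 'I_(m * lam) -> nat)
    (P Q : pred 'I_(m * lam)) :
  is_fsquare T -> (forall i j, odd (f (i, j)) = P i (+) Q j) ->
  odd (\sum_(p | T p.1 p.2 == s) f p) = odd (lam * (#|P| + #|Q|)).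
Proof.
move=> [Trow Tcol] fE.
have cardE (R : pred 'I_(m * lam)) : #|R| = \sum_i R i.
  by rewrite -sum1_card big_mkcond; apply: eq_bigr => i _; rewrite unfold_in; case: (R i).
have sumP : \sum_(p | T p.1 p.2 == s) P p.1 = lam * #|P|.
  rewrite -(pair_big_dep xpredT (fun i j => T i j == s) (fun i _ => P i : nat)) /=.
  rewrite cardE big_distrr; apply: eq_bigr => i _ /=.
  by have := Trow i s; rewrite cardsE sum_nat_const => ->.
have sumQ : \sum_(p | T p.1 p.2 == s) Q p.2 = lam * #|Q|.
  rewrite -(pair_big_dep xpredT (fun i j => T i j == s) (fun _ j => Q j : nat)) /=.
  rewrite (exchange_big_dep xpredT) //= cardE big_distrr.
  apply: eq_bigr => j _ /=.
  by have := Tcol j s; rewrite cardsE sum_nat_const => ->.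
rewrite mulnDr -sumP -sumQ -big_split /= !(big_morph odd oddD (erefl (odd 0))).
by apply: eq_bigr => -[i j] _; rewrite fE oddD !oddb.
Qed.

Lemma sum_ones A T (s : 'I_m) :
  \sum_(p | T p.1 p.2 == s) ones A p =
  \sum_(S in A) #|[set p : 'I_(m * lam) * 'I_(m * lam) |
                    (T p.1 p.2 == s) && (S p.1 p.2 == 0 :> nat)]|.
Proof.
rewrite exchange_big; apply: eq_bigr => S _.
by rewrite -big_mkcondr sum1dep_card.
Qed.

(** Two unequal values of [ones] are what later excludes [m = 1] and an empty [A], since [ones] is
    constant in both cases. *)
Lemma nonconstant_ones A :
  nonconstant_full_relation A -> 0 < m * lam ->
  exists P Q : pred 'I_(m * lam),
    (forall i j, odd (ones A (i, j)) = P i (+) Q j) /\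
    exists p q, ones A p != ones A q.
Proof.
move=> [x [y [xn yn nxy /full_relation_odd[r [c rel]]]]] n0.
exists (fun i => (r^-1)%g i < x), (fun j => (c^-1)%g j < y); split.
  by move=> i j; rewrite -rel !permKV.
have ltn1 : (m * lam).-1 < m * lam by rewrite prednK.
pose o := Ordinal n0; pose z := Ordinal ltn1.
(* If the first and last indices lie on the same side of the threshold [w], then [w] is extreme. *)
have ends w : w <= m * lam -> (0 < w) = ((m * lam).-1 < w) ->
    w = 0 \/ w = m * lam.
  case: (posnP w) => [|w0]; first by left.
  move=> wn /esym; rewrite prednK // => nw.
  by right; apply/eqP; rewrite eqn_leq wn.
case: (eqVneq (0 < x) ((m * lam).-1 < x)) => [ex | nx].
  case: (eqVneq (0 < y) ((m * lam).-1 < y)) => [ey | ny].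
    by case: nxy; split; apply: ends.
  (* Here [y] separates the first and last columns, so the parity changes along a row. *)
  exists (r o, c o), (r o, c z); apply: contra_neq ny => /(congr1 odd).
  by rewrite !rel => /addbI.
exists (r o, c o), (r z, c o); apply: contra_neq nx => /(congr1 odd).
by rewrite !rel => /addIb.
Qed.

End Parity.

Theorem theorem13 (m lam : nat) (A : {set square m lam})
    (hm : 0 < m) (hlam : 0 < lam) (hodd : odd lam)
    (hA : is_MOFS A) (hrel : nonconstant_full_relation A) :
  is_maximal_MOFS A.
Proof.
split=> // -[T [fT orthT]].
have [fA orthA] := hA.
have [|P [Q [PQ [p [q /eqP pq]]]]] := nonconstant_ones hrel.
  by rewrite muln_gt0 hm.
have m1 : 1 < m.
  rewrite ltnNge; apply/negP => m1; apply: pq; apply: eq_bigr => S _.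
  have S0 i j : S i j = 0 :> nat.
    by apply/eqP; rewrite -leqn0 -ltnS (leq_trans (ltn_ord _)).
  by rewrite !S0.
have [S0 S0A] : exists S0, S0 \in A.
  apply/set0Pn; apply/eqP => A0; apply: pq.
  by rewrite /ones A0 !big_set0.
pose s0 := Ordinal hm; pose s1 := Ordinal m1.
have zeroE (U S : square m lam) (s : 'I_m) : orthogonal_fsquares U S ->
    #|[set p : 'I_(m * lam) * 'I_(m * lam) |
        (U p.1 p.2 == s) && (S p.1 p.2 == 0 :> nat)]| = lam ^ 2.
  by move=> /(_ s s0).
have := odd_sum_fsquare s1 fT PQ.
have := odd_sum_fsquare s1 (fA _ S0A) PQ.
rewrite !sum_ones (bigD1 S0) //= (bigD1 S0 (P := mem A)) //=.
rewrite (zeroE T S0 s1 (orthT _ S0A)).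
(* A cell of [S0] cannot hold both [s1] and [s0]. *)
have -> : [set p : 'I_(m * lam) * 'I_(m * lam) |
    (S0 p.1 p.2 == s1) && (S0 p.1 p.2 == 0 :> nat)] = set0.
  by apply/setP => u; rewrite !inE; case: eqP => // ->.
rewrite cards0 add0n => <-.
(* By orthogonality the other squares contribute equally to both sums, which thus differ by the odd
   number [lam ^ 2]. *)
have -> : \sum_(S in A | S != S0) #|[set p : 'I_(m * lam) * 'I_(m * lam) |
      (T p.1 p.2 == s1) && (S p.1 p.2 == 0 :> nat)]| =
    \sum_(S in A | S != S0) #|[set p : 'I_(m * lam) * 'I_(m * lam) |
      (S0 p.1 p.2 == s1) && (S p.1 p.2 == 0 :> nat)]|.
  apply: eq_bigr => S /andP[SA SS0].
  by rewrite !zeroE //; [apply: orthA; rewrite // eq_sym | apply: orthT].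
by rewrite oddD oddX hodd; case: (odd _).
Qed.
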